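(* If $\mathcal{F}$ is a finitary argumentation framework, then it has an $\mathit{stg1.5}$-extension, i.e., $\mathit{stg1.5}(\mathcal{F})\neq\emptyset$.
   Context: An argumentation framework (AF) is $\mathcal{F}=(A_{\mathcal{F}},R_{\mathcal{F}})$ with $R_{\mathcal{F}}\subseteq A_{\mathcal{F}}\times A_{\mathcal{F}}$ (possibly infinite); $a\rightarrow b$ means $(a,b)\in R_{\mathcal{F}}$. $\mathcal{F}$ is finitary if each argument is attacked by only finitely many arguments. $\mathcal{F}|_S=(A_{\mathcal{F}}\cap S,R_{\mathcal{F}}\cap(S\times S))$. $S$ is conflict-free if no $a,b\in S$ have $a\rightarrow b$; $S^\oplus=S\cup\{x:\exists y\in S,\ y\rightarrow x\}$; a stage extension of an AF is a conflict-free $S$ such that there is no conflict-free $T$ with $S^\oplus\subsetneq T^\oplus$. $\mathrm{SCC}(\mathcal{F})$ is the set of strongly connected components of the attack graph (paths possibly of length 0). For $X,S\subseteq A_{\mathcal{F}}$, $D_S(X)=\{b\in X:\exists a\in S\setminus X,\ a\rightarrow b\}$. $S\in\mathit{stg1.5}(\mathcal{F})$ iff $S$ is conflict-free and for each $X\in\mathrm{SCC}(\mathcal{F})$, $S\cap X$ is a stage extension of $\mathcal{F}|_{X\setminus D_S(X)}$. *)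

(* Defs.v *)
(* An argumentation framework over a carrier type U is given by
   a set of arguments [Ar : U -> Prop] and an attack relation [At : U -> U -> Prop]
   with [At a b -> Ar a /\ Ar b] (R_F subset of A_F x A_F). Possibly infinite. *)
From Stdlib Require Import List Relations.

Set Implicit Arguments.

Section AF.
Variable U : Type.

Definition wf_AF (Ar : U -> Prop) (At : U -> U -> Prop) : Prop :=
  forall a b, At a b -> Ar a /\ Ar b.

Definition finitary (Ar : U -> Prop) (At : U -> U -> Prop) : Prop :=
  forall b, Ar b -> exists l : list U, forall a, At a b -> In a l.

Definition restr_args (Ar : U -> Prop) (S : U -> Prop) : U -> Prop :=
  fun x => Ar x /\ S x.
Definition restr_att (At : U -> U -> Prop) (S : U -> Prop) : U -> U -> Prop :=
  fun a b => At a b /\ S a /\ S b.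

Definition conflict_free (Ar : U -> Prop) (At : U -> U -> Prop) (S : U -> Prop) : Prop :=
  (forall x, S x -> Ar x) /\ (forall a b, S a -> S b -> ~ At a b).

Definition range (At : U -> U -> Prop) (S : U -> Prop) : U -> Prop :=
  fun x => S x \/ exists y, S y /\ At y x.

Definition stage (Ar : U -> Prop) (At : U -> U -> Prop) (S : U -> Prop) : Prop :=
  conflict_free Ar At S /\
  ~ (exists T, conflict_free Ar At T /\
       (forall x, range At S x -> range At T x) /\
       (exists x, range At T x /\ ~ range At S x)).

Definition reach (At : U -> U -> Prop) : U -> U -> Prop := clos_refl_trans U At.

Definition is_SCC (Ar : U -> Prop) (At : U -> U -> Prop) (X : U -> Prop) : Prop :=
  exists a, Ar a /\
    forall b, X b <-> (Ar b /\ reach At a b /\ reach At b a).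

Definition D_set (At : U -> U -> Prop) (S X : U -> Prop) : U -> Prop :=
  fun b => X b /\ exists a, S a /\ ~ X a /\ At a b.

Definition stg15 (Ar : U -> Prop) (At : U -> U -> Prop) (S : U -> Prop) : Prop :=
  conflict_free Ar At S /\
  forall X, is_SCC Ar At X ->
    let Y := fun x => X x /\ ~ D_set At S X x in
    stage (restr_args Ar Y) (restr_att At Y) (fun x => S x /\ X x).

End AF.

(* Main.v *)
Require Import Defs.
From Stdlib Require Import List Relations Sorted Permutation Lia.
From Stdlib Require Import Classical IndefiniteDescription.
From mathcomp Require choice boolp filter.

(** A strongly connected component of a finitary framework is countable, so its
    arguments can be ranked injectively by natural numbers.  Ask of [S] that, on
    each component, its range be lexicographically maximal for this ranking: [x]
    is in the range as soon as some competitor [T] has in its range [x] and all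
    the arguments of smaller rank that [S] has in its range.  This implies the
    stage condition, and each single instance of it depends on finitely many
    arguments only, because a finite part of [T] suffices to cover [x] and the
    arguments of smaller rank.  Finitely many instances can be satisfied by
    treating the components involved in topological order, so by compactness
    all of them can be.  The components need not be well-founded, which is why
    compactness is used rather than recursion on components. *)

Definition inter {U : Type} (A B : U -> Prop) : U -> Prop := fun x => A x /\ B x.

Definition injective_on {I : Type} (D : I -> Prop) (f : I -> nat) : Prop :=
  forall i j, D i -> D j -> f i = f j -> i = j.

Lemma injective_on_finite_below {I : Type} (D : I -> Prop) (rank : I -> nat) n :
  injective_on D rank -> exists l, forall i, D i -> rank i < n -> In i l.
Proof.
intro rank_inj. induction n as [|n [l Hl]].
- exists nil. intros; lia.
- destruct (classic (exists i, D i /\ rank i = n)) as [[i [Di rank_i]]|none].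
  + exists (i :: l). intros j Dj Hj. destruct (PeanoNat.Nat.eq_dec (rank j) n).
    * left. apply rank_inj; congruence.
    * right. apply Hl; [exact Dj|lia].
  + exists l. intros j Dj Hj. apply Hl; [exact Dj|].
    assert (rank j <> n) by (intro; apply none; exists j; auto). lia.
Qed.

(** * Compactness *)

Section Compactness.
Context {U I : Type}.

Definition agree_on (Z : list U) (S S' : U -> Prop) : Prop :=
  forall z, In z Z -> (S z <-> S' z).

(* Closedness for the product topology on [U -> Prop]. *)
Definition pointwise_closed (C : (U -> Prop) -> Prop) : Prop :=
  forall S, (forall Z, exists S', agree_on Z S S' /\ C S') -> C S.

Lemma pointwise_closed_and (C C' : (U -> Prop) -> Prop) :
  pointwise_closed C -> pointwise_closed C' ->
  pointwise_closed (fun S => C S /\ C' S).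
Proof.
intros C_closed C'_closed S S_approx. split.
- apply C_closed. intro Z. destruct (S_approx Z) as [S' [SS' [CS' _]]].
  exists S'. auto.
- apply C'_closed. intro Z. destruct (S_approx Z) as [S' [SS' [_ C'S']]].
  exists S'. auto.
Qed.

Lemma fine_ultrafilter :
  exists W : (list I -> Prop) -> Prop,
    filter.UltraFilter W /\ forall i, W (In i).
Proof.
assert (tails : filter.ProperFilter
  (filter.filter_from classical_sets.setT (fun l l' : list I => incl l l'))).
{ apply filter.filter_from_proper.
  - apply filter.filter_fromT_filter; [exists nil; exact Logic.I|].
    intros l1 l2. exists (l1 ++ l2). intros l Hl.
    split; intros i Hi; apply Hl, in_or_app; auto.
  - intros l _. exists l. apply incl_refl. }
destruct (filter.ultraFilterLemma tails) as [W [W_ultra tails_W]].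
exists W. split; [exact W_ultra|]. intro i. apply tails_W.
exists (i :: nil); [exact Logic.I|]. intros l Hl. apply Hl. left; reflexivity.
Qed.

Lemma ultralimit_agree_on {J : Type} (W : (J -> Prop) -> Prop)
    (F : J -> U -> Prop) (Z : list U) :
  filter.UltraFilter W ->
  W (fun j => agree_on Z (fun z => W (fun j => F j z)) (F j)).
Proof.
intro W_ultra.
assert (W_proper := @filter.ultra_proper _ _ W_ultra).
assert (W_filter := @filter.filter_filter _ _ W_proper).
assert (agree_at : forall z, W (fun j => W (fun j => F j z) <-> F j z)).
{ intro z.
  destruct (filter.in_ultra_setVsetC (fun j => F j z) W_ultra) as [Wz|Wz].
  - refine (filter.filterS _ Wz). intros j Fjz. split; auto.
  - refine (filter.filterS _ Wz). intros j Fjz. split; [|contradiction].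
    intro Wz'. destruct (filter.filter_ex (filter.filterI Wz Wz')) as [k [H H']].
    contradiction. }
induction Z as [|z Z IH].
- apply filter.filterE; [exact W_filter|]. intros j z [].
- refine (filter.filterS _ (filter.filterI (agree_at z) IH)).
  intros j [Hz HZ] z' [<-|Hz']; auto.
Qed.

Lemma pointwise_compactness (C : I -> (U -> Prop) -> Prop) :
  (forall i, pointwise_closed (C i)) ->
  (forall l, exists S, forall i, In i l -> C i S) ->
  exists S, forall i, C i S.
Proof.
intros C_closed C_finite.
destruct (functional_choice _ C_finite) as [F CF].
destruct fine_ultrafilter as [W [W_ultra W_fine]].
assert (W_proper := @filter.ultra_proper _ _ W_ultra).
assert (W_filter := @filter.filter_filter _ _ W_proper).
exists (fun z => W (fun l => F l z)). intro i. apply C_closed. intro Z.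
destruct (filter.filter_ex
  (filter.filterI (W_fine i) (ultralimit_agree_on W F Z W_ultra))) as [l [Hi HZ]].
exists (F l). auto.
Qed.

End Compactness.

(** * Lexicographic maxima *)

Section LexicographicMaximum.
Context {V I : Type} (D : I -> Prop) (rank : I -> nat).
Context (P : V -> Prop) (R : V -> I -> Prop).

Definition lex_maximal_at (v : V) (i : I) : Prop :=
  forall w, P w -> (forall j, D j -> rank j < rank i -> R v j -> R w j) ->
    R w i -> R v i.

Lemma lex_maximal_below (n : nat) :
  injective_on D rank -> (exists v, P v) ->
  exists v, P v /\ forall i, D i -> rank i < n -> lex_maximal_at v i.
Proof.
intros rank_inj [v0 Pv0]. induction n as [|n [v [Pv v_max]]].
{ exists v0. split; [exact Pv0|]. intros; lia. }
destruct (classic (exists w i, P w /\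
    (forall j, D j -> rank j < n -> R v j -> R w j) /\
    D i /\ rank i = n /\ R w i)) as [[w [i [Pw [vw [Di [rank_i Rwi]]]]]]|none].
- exists w. split; [exact Pw|]. intros j Dj Hj u Pu wu Ruj.
  destruct (PeanoNat.Nat.eq_dec (rank j) n) as [rank_j|rank_j].
  + replace j with i by (apply rank_inj; congruence). exact Rwi.
  + apply vw; [exact Dj|lia|]. apply (v_max j Dj) with u;
      [lia|exact Pu| |exact Ruj].
    intros k Dk Hk Rvk. apply wu; [exact Dk|exact Hk|].
    apply vw; [exact Dk|lia|exact Rvk].
- exists v. split; [exact Pv|]. intros j Dj Hj u Pu vu Ruj.
  destruct (PeanoNat.Nat.eq_dec (rank j) n) as [rank_j|rank_j].
  + destruct none. exists u, j. rewrite <- rank_j. auto.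
  + apply (v_max j Dj) with u; [lia|exact Pu|exact vu|exact Ruj].
Qed.

End LexicographicMaximum.

(** * Topological sorting *)

Section TopologicalSort.
Context {U : Type} (R : relation U) (R_trans : transitive U R).

Definition not_strictly_before (a b : U) : Prop := R a b -> R b a.

Lemma topological_sort_insert (c : U) (l : list U) :
  StronglySorted not_strictly_before l ->
  exists l', Permutation (c :: l) l' /\ StronglySorted not_strictly_before l'.
Proof.
induction 1 as [|a l l_sorted [l' [l'_perm l'_sorted]] a_l].
{ exists (c :: nil). split; [reflexivity|]. repeat constructor. }
destruct (classic (R a c)) as [Rac|nRac].
- exists (c :: a :: l). split; [reflexivity|].
  constructor; [constructor; assumption|].
  constructor; [intros _; exact Rac|].
  rewrite Forall_forall in *. intros b Hb Rcb.
  apply R_trans with a; [|exact Rac]. apply a_l; [exact Hb|].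
  apply R_trans with c; assumption.
- exists (a :: l'). split.
  + rewrite perm_swap. apply perm_skip, l'_perm.
  + constructor; [exact l'_sorted|].
    apply (Permutation_Forall l'_perm). constructor; [|exact a_l].
    intro Rac. contradiction.
Qed.

Lemma topological_sort (l : list U) :
  exists l', Permutation l l' /\ StronglySorted not_strictly_before l'.
Proof.
induction l as [|a l [l1 [perm1 sorted1]]].
{ exists nil. split; constructor. }
destruct (topological_sort_insert a l1 sorted1) as [l2 [perm2 sorted2]].
exists l2. split; [|exact sorted2]. rewrite perm1. exact perm2.
Qed.

End TopologicalSort.

(** * Components, defeat and range *)

Section Frameworks.
Context {U : Type} (Ar : U -> Prop) (At : U -> U -> Prop).

Definition scc (a : U) : U -> Prop := fun b => reach At a b /\ reach At b a.

Lemma scc_refl a : scc a a.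
Proof. split; apply rt_refl. Qed.

Lemma scc_eq a b : scc a b -> scc a = scc b.
Proof.
intros [ab ba]. apply boolp.predeqP. intro x.
split; intros [H H']; split; eapply rt_trans; eassumption.
Qed.

Lemma reach_args a b : wf_AF Ar At -> reach At a b -> Ar b -> Ar a.
Proof.
intros Hwf H. induction H as [a b Hab| |]; auto.
intros _. exact (proj1 (Hwf _ _ Hab)).
Qed.

Lemma is_SCC_scc (X : U -> Prop) :
  wf_AF Ar At -> is_SCC Ar At X -> exists a, X = scc a.
Proof.
intros Hwf [a [Ha HX]]. exists a. apply boolp.predeqP. intro b. rewrite HX.
split; [intros [_ H]; exact H|]. intros [ab ba].
split; [exact (reach_args _ _ Hwf ba Ha)|split; assumption].
Qed.

Definition undefeated (S X : U -> Prop) : U -> Prop :=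
  fun x => X x /\ ~ D_set At S X x.

Lemma undefeated_ext (S S' X : U -> Prop) x :
  (X x -> forall y, At y x -> ~ X y -> (S y <-> S' y)) ->
  undefeated S X x <-> undefeated S' X x.
Proof.
intro SS'. unfold undefeated.
enough (D_set At S X x <-> D_set At S' X x) by tauto.
split; intros [Xx [y [Sy [nXy yx]]]];
  (split; [exact Xx|]; exists y; split; [apply SS'|]; auto).
Qed.

Lemma range_ext (S S' : U -> Prop) x :
  (S x <-> S' x) -> (forall y, At y x -> (S y <-> S' y)) ->
  range At S x <-> range At S' x.
Proof.
intros Sx SS'. unfold range. rewrite Sx.
split; (intros [H|[y [Sy yx]]]; [left; exact H|right]);
  (exists y; split; [apply SS'|]; assumption).
Qed.

Definition conflict_free_within (Y T : U -> Prop) : Prop :=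
  conflict_free Ar At T /\ forall x, T x -> Y x.

Lemma conflict_free_restr (Y T : U -> Prop) :
  conflict_free (restr_args Ar Y) (restr_att At Y) T <-> conflict_free_within Y T.
Proof.
split.
- intros [T_args T_cf]. split; [split|]; try (intros x Tx; apply T_args, Tx).
  intros x y Tx Ty xy. apply (T_cf x y Tx Ty).
  split; [exact xy|]. split; apply T_args; assumption.
- intros [[T_args T_cf] TY]. split; [intros x Tx; split; auto|].
  intros x y Tx Ty [xy _]. exact (T_cf x y Tx Ty xy).
Qed.

Lemma range_restr (Y T : U -> Prop) x :
  (forall y, T y -> Y y) -> (range (restr_att At Y) T x <-> Y x /\ range At T x).
Proof.
intro TY. split.
- intros [Tx|[y [Ty [yx [_ Yx]]]]].
  + split; [apply TY|left]; exact Tx.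
  + split; [exact Yx|]. right. exists y. auto.
- intros [Yx [Tx|[y [Ty yx]]]]; [left; exact Tx|].
  right. exists y. split; [exact Ty|]. split; auto.
Qed.

Lemma conflict_free_within_undefeated (S X : U -> Prop) :
  conflict_free Ar At S -> conflict_free_within (undefeated S X) (inter S X).
Proof.
intros [S_args S_cf]. split; [split|].
- intros x [Sx _]. exact (S_args x Sx).
- intros x y [Sx _] [Sy _]. exact (S_cf x y Sx Sy).
- intros x [Sx Xx]. split; [exact Xx|]. intros [_ [y [Sy [_ yx]]]].
  exact (S_cf y x Sy Sx yx).
Qed.

Lemma conflict_free_pointwise_closed : pointwise_closed (conflict_free Ar At).
Proof.
intros S S_approx. split.
- intros x Sx. destruct (S_approx (x :: nil)) as [S' [SS' [S'_args _]]].
  apply S'_args, SS'; [left; reflexivity|exact Sx].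
- intros x y Sx Sy. destruct (S_approx (x :: y :: nil)) as [S' [SS' [_ S'_cf]]].
  apply S'_cf; apply SS'; simpl; auto.
Qed.

(** * Attackers and ranks *)

Lemma finitary_attackers :
  wf_AF Ar At -> finitary Ar At ->
  exists attackers : U -> list U, forall a b, At a b -> In a (attackers b).
Proof.
intros Hwf Hfin.
destruct (functional_choice (fun b l => forall a, At a b -> In a l))
  as [attackers attackers_spec].
- intro b. destruct (classic (Ar b)) as [Ab|nAb]; [exact (Hfin b Ab)|].
  exists nil. intros a ab. exact (nAb (proj2 (Hwf a b ab))).
- exists attackers. intros a b. apply attackers_spec.
Qed.

Context (attackers : U -> list U).
Context (attackers_spec : forall a b, At a b -> In a (attackers b)).

Definition with_attackers (l : list U) : list U := l ++ flat_map attackers l.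

Lemma in_with_attackers (l : list U) x : In x l -> In x (with_attackers l).
Proof. intro Hx. apply in_or_app. auto. Qed.

Lemma attacker_in_with_attackers (l : list U) x y :
  In x l -> At y x -> In y (with_attackers l).
Proof.
intros Hx yx. apply in_or_app. right. apply in_flat_map. exists x. auto.
Qed.

Lemma agree_on_range (l : list U) (S S' : U -> Prop) :
  agree_on (with_attackers l) S S' -> agree_on l (range At S) (range At S').
Proof.
intros SS' x Hx. apply range_ext.
- apply SS', in_with_attackers, Hx.
- intros y yx. apply SS', attacker_in_with_attackers with x; assumption.
Qed.

Lemma agree_on_undefeated (l : list U) (S S' X : U -> Prop) :
  agree_on (with_attackers l) S S' ->
  agree_on l (undefeated S X) (undefeated S' X).
Proof.
intros SS' x Hx. apply undefeated_ext. intros _ y yx _.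
apply SS', attacker_in_with_attackers with x; assumption.
Qed.

Lemma ancestors_injective_rank (a : U) :
  exists rank, injective_on (fun b => reach At b a) rank.
Proof.
set (climb := fold_left (fun b i => nth i (attackers b) b)).
assert (climb_onto : forall b, reach At b a -> exists s, climb s a = b).
{ intros b ba. apply clos_rt_rt1n in ba.
  induction ba as [a|b c a bc _ IH]; [exists nil; reflexivity|].
  destruct IH as [s Hs].
  destruct (In_nth _ _ c (attackers_spec b c bc)) as [i [_ Hi]].
  exists (s ++ i :: nil).
  transitivity (climb (i :: nil) (climb s a)); [apply fold_left_app|].
  rewrite Hs. exact Hi. }
destruct (functional_choice (fun b n => reach At b a ->
  climb (choice.CodeSeq.decode n) a = b)) as [rank rank_spec].
{ intro b. destruct (classic (reach At b a)) as [ba|]; [|exists 0; contradiction].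
  destruct (climb_onto b ba) as [s Hs]. exists (choice.CodeSeq.code s).
  rewrite choice.CodeSeq.codeK. auto. }
exists rank. intros b c ba ca bc.
rewrite <- (rank_spec b ba), bc. apply rank_spec, ca.
Qed.

Lemma scc_injective_rank : exists rank, forall a, injective_on (scc a) rank.
Proof.
destruct (functional_choice (fun X rank =>
  forall a, X = scc a -> injective_on X rank)) as [rank_in rank_in_inj].
{ intro X. destruct (classic (exists a, X = scc a)) as [[a ->]|none].
  - destruct (ancestors_injective_rank a) as [rank rank_inj]. exists rank.
    intros _ _ b c [_ ba] [_ ca]. apply rank_inj; assumption.
  - exists (fun _ => 0). intros a Xa. destruct none. exists a. exact Xa. }
exists (fun x => rank_in (scc x) x). intros a b c ab ac.
rewrite <- (scc_eq a b ab), <- (scc_eq a c ac).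
apply (rank_in_inj (scc a) a eq_refl); assumption.
Qed.

(** * Greedy sets *)

Context (rank : U -> nat).

Definition greedy_at (S : U -> Prop) (x : U) : Prop :=
  let Y := undefeated S (scc x) in
  Y x -> lex_maximal_at Y rank (conflict_free_within Y) (range At)
           (inter S (scc x)) x.

Lemma greedy_stg15 (S : U -> Prop) :
  wf_AF Ar At -> conflict_free Ar At S -> (forall x, greedy_at S x) ->
  stg15 Ar At S.
Proof.
intros Hwf S_cf S_greedy. split; [exact S_cf|]. intros X X_scc.
destruct (is_SCC_scc X Hwf X_scc) as [a ->].
change (stage (restr_args Ar (undefeated S (scc a)))
  (restr_att At (undefeated S (scc a))) (inter S (scc a))).
set (Y := undefeated S (scc a)).
assert (S_within : conflict_free_within Y (inter S (scc a)))
  by apply conflict_free_within_undefeated, S_cf.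
split; [apply conflict_free_restr, S_within|].
intros [T [T_cf [S_le_T [x [Tx nSx]]]]]. apply nSx.
apply conflict_free_restr in T_cf.
apply (range_restr Y T x (proj2 T_cf)) in Tx. destruct Tx as [Yx Tx].
apply range_restr; [apply S_within|]. split; [exact Yx|].
assert (x_greedy := S_greedy x). unfold greedy_at in x_greedy.
rewrite <- (scc_eq a x (proj1 Yx)) in x_greedy.
apply (x_greedy Yx T T_cf); [|exact Tx].
intros y Yy _ Sy. apply (range_restr Y T y (proj2 T_cf)), S_le_T.
apply range_restr; [apply S_within|]. split; assumption.
Qed.

Lemma greedy_at_ext (S S' : U -> Prop) x :
  (forall y, reach At y x -> (S y <-> S' y)) -> greedy_at S x -> greedy_at S' x.
Proof.
intro SS'. unfold greedy_at.
replace (undefeated S' (scc x)) with (undefeated S (scc x)).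
- replace (inter S' (scc x)) with (inter S (scc x)); [tauto|].
  apply boolp.predeqP. intro y. unfold inter.
  split; intros [Sy xy]; (split; [apply (SS' y (proj2 xy))|]; assumption).
- apply boolp.predeqP. intro y. apply undefeated_ext. intros [_ yx] z zy _.
  apply SS', rt_trans with y; [apply rt_step, zy|exact yx].
Qed.

Definition override_from (S : U -> Prop) (a : U) (T : U -> Prop) : U -> Prop :=
  fun y => T y \/ (S y /\ ~ reach At a y).

Lemma override_from_outside (S T : U -> Prop) a y :
  (forall x, T x -> scc a x) -> ~ reach At a y ->
  (S y <-> override_from S a T y).
Proof.
intros TX nay. split; [intro Sy; right; auto|].
intros [Ty|[Sy _]]; [|exact Sy]. destruct (nay (proj1 (TX y Ty))).
Qed.

Lemma override_from_conflict_free (S T : U -> Prop) a :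
  conflict_free Ar At S -> conflict_free_within (undefeated S (scc a)) T ->
  conflict_free Ar At (override_from S a T).
Proof.
intros [S_args S_cf] [[T_args T_cf] TY].
split; [intros x [Tx|[Sx _]]; auto|].
intros x y [Tx|[Sx nax]] [Ty|[Sy nay]] xy.
- exact (T_cf x y Tx Ty xy).
- destruct (TY x Tx) as [[ax _] _]. apply nay.
  apply rt_trans with x; [exact ax|apply rt_step, xy].
- destruct (TY y Ty) as [ay not_defeated]. apply not_defeated.
  split; [exact ay|]. exists x. split; [exact Sx|]. split; [|exact xy].
  intros [ax _]. contradiction.
- exact (S_cf x y Sx Sy xy).
Qed.

Lemma undefeated_override_from (S T : U -> Prop) a :
  (forall x, T x -> scc a x) ->
  undefeated (override_from S a T) (scc a) = undefeated S (scc a).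
Proof.
intro TX. apply boolp.predeqP. intro x. apply undefeated_ext.
intros [_ xa] y yx nXy.
apply iff_sym, override_from_outside; [exact TX|]. intro ay. apply nXy.
split; [exact ay|]. apply rt_trans with x; [apply rt_step, yx|exact xa].
Qed.

Lemma inter_override_from (S T : U -> Prop) a :
  (forall x, T x -> scc a x) -> inter (override_from S a T) (scc a) = T.
Proof.
intro TX. apply boolp.predeqP. intro x. split.
- intros [[Tx|[_ nax]] [ax _]]; [exact Tx|contradiction].
- intro Tx. split; [left|apply TX]; exact Tx.
Qed.

Context (rank_inj : forall a, injective_on (scc a) rank).

Lemma greedy_below_extension (S : U -> Prop) (a : U) (n : nat) :
  conflict_free Ar At S ->
  exists S', conflict_free Ar At S' /\
    (forall y, ~ reach At a y -> (S y <-> S' y)) /\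
    (forall x, scc a x -> rank x < n -> greedy_at S' x).
Proof.
intro S_cf. set (Y := undefeated S (scc a)).
destruct (lex_maximal_below Y rank (conflict_free_within Y) (range At) n)
  as [T [T_within T_max]].
{ intros x y [ax _] [ay _]. apply (rank_inj a); assumption. }
{ exists (fun _ => False). split; [split|]; tauto. }
assert (TX : forall x, T x -> scc a x) by (intros x Tx; apply T_within, Tx).
exists (override_from S a T). split; [|split].
- apply override_from_conflict_free; assumption.
- intros y nay. apply override_from_outside; assumption.
- intros x ax x_n. unfold greedy_at. rewrite <- (scc_eq a x ax).
  rewrite undefeated_override_from, inter_override_from by exact TX.
  intro Yx. exact (T_max x Yx x_n).
Qed.

Lemma greedy_on_sorted (l : list U) :
  StronglySorted (not_strictly_before (reach At)) l ->
  exists S, conflict_free Ar At S /\ forall x, In x l -> greedy_at S x.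
Proof.
induction 1 as [|a l _ [S [S_cf S_greedy]] a_l].
{ exists (fun _ => False). split; [split; tauto|]. intros x []. }
(* The head [a] is last in attack order, so a change of [S] downstream of [a]
   does not affect the other components met by the list. *)
destruct (greedy_below_extension S a (1 + list_max (map rank (a :: l))) S_cf)
  as [S' [S'_cf [S_S' S'_greedy]]].
exists S'. split; [exact S'_cf|]. intros x Hx.
destruct (classic (scc a x)) as [ax|nax].
- apply S'_greedy; [exact ax|].
  assert (ranks := proj1 (list_max_le (map rank (a :: l)) _) (le_n _)).
  rewrite Forall_forall in ranks.
  apply PeanoNat.Nat.lt_succ_r, ranks, in_map, Hx.
- destruct Hx as [<-|Hx]; [destruct (nax (scc_refl a))|].
  apply greedy_at_ext with S; [|exact (S_greedy x Hx)].
  intros y yx. apply S_S'. intro ay. apply nax.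
  assert (ax : reach At a x) by (apply rt_trans with y; assumption).
  rewrite Forall_forall in a_l. split; [exact ax|]. exact (a_l x Hx ax).
Qed.

Lemma greedy_on_list (l : list U) :
  exists S, conflict_free Ar At S /\ forall x, In x l -> greedy_at S x.
Proof.
destruct (topological_sort (reach At) (rt_trans U At) l)
  as [l' [l_l' l'_sorted]].
destruct (greedy_on_sorted l' l'_sorted) as [S [S_cf S_greedy]].
exists S. split; [exact S_cf|]. intros x Hx.
apply S_greedy, (Permutation_in x l_l'), Hx.
Qed.

Lemma greedy_at_pointwise_closed x : pointwise_closed (fun S => greedy_at S x).
Proof.
intros S S_approx Yx T [[T_args T_cf] TY] S_le_T Tx.
destruct (injective_on_finite_below (scc x) rank (1 + rank x) (rank_inj x))
  as [l Hl].
set (l1 := with_attackers l).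
destruct (S_approx (with_attackers l1)) as [S' [SS' S'_greedy]].
assert (SS'_l1 : agree_on l1 (inter S (scc x)) (inter S' (scc x))).
{ intros y Hy. unfold inter. rewrite (SS' y (in_with_attackers _ _ Hy)). tauto. }
assert (YY' := agree_on_undefeated l1 S S' (scc x) SS').
assert (range_SS' := agree_on_range l _ _ SS'_l1).
set (T' := inter T (fun y => In y l1)).
assert (range_TT' : agree_on l (range At T) (range At T')).
{ apply agree_on_range. intros y Hy. unfold T', inter. tauto. }
assert (x_l : In x l) by (apply Hl; [apply scc_refl|lia]).
apply (range_SS' x x_l).
apply (S'_greedy (proj1 (YY' x (in_with_attackers _ _ x_l)) Yx) T').
- split; [split|].
  + intros y [Ty _]. exact (T_args y Ty).
  + intros y z [Ty _] [Tz _]. exact (T_cf y z Ty Tz).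
  + intros y [Ty Hy]. apply (YY' y Hy), TY, Ty.
- intros y Y'y y_x S'y.
  assert (y_l : In y l) by (apply Hl; [exact (proj1 Y'y)|lia]).
  apply (range_TT' y y_l), S_le_T; [|exact y_x|apply (range_SS' y y_l), S'y].
  apply (YY' y (in_with_attackers _ _ y_l)), Y'y.
- apply (range_TT' x x_l), Tx.
Qed.

Lemma greedy_exists :
  exists S, conflict_free Ar At S /\ forall x, greedy_at S x.
Proof.
destruct (pointwise_compactness
  (fun x S => conflict_free Ar At S /\ greedy_at S x)) as [S HS].
- intro x. apply pointwise_closed_and.
  + exact conflict_free_pointwise_closed.
  + exact (greedy_at_pointwise_closed x).
- intro l. destruct (greedy_on_list l) as [S [S_cf S_greedy]].
  exists S. auto.
- exists S. split; [split|].
  + intros x. apply (HS x).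
  + intros x y. apply (HS x).
  + intro x. apply (HS x).
Qed.

End Frameworks.

Theorem theorem5 (U : Type) (Ar : U -> Prop) (At : U -> U -> Prop)
  (Hwf : wf_AF Ar At) (Hfin : finitary Ar At) :
  exists S : U -> Prop, stg15 Ar At S.
Proof.
destruct (finitary_attackers Ar At Hwf Hfin) as [attackers attackers_spec].
destruct (scc_injective_rank At attackers attackers_spec) as [rank rank_inj].
destruct (greedy_exists Ar At attackers attackers_spec rank rank_inj)
  as [S [S_cf S_greedy]].
exists S. exact (greedy_stg15 Ar At rank S Hwf S_cf S_greedy).
Qed.
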